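(* Consider the over-the-air federated learning system described in the context, with the correlated perturbation mechanism, observed by the adversary over $T$ rounds. Suppose that for every round $t\in\{1,\dots,T\}$, every sample-wise gradient satisfies $\|\nabla f(\mathbf{w}^{(t)},\boldsymbol{\mu},\nu)\|\le\gamma^{(t)}$ for all possible data points $(\boldsymbol{\mu},\nu)$. Let $\rho^{(t)}_{\max}=\max_k|\rho^{(t)}_k|$ and let $C(x)=\sqrt{\pi}\,x\,e^{x^2}$ for $x>0$ (which is strictly increasing on $(0,\infty)$, with inverse $C^{-1}$). If $$\sum_{t=1}^{T}\left(\frac{2\gamma^{(t)}}{m^{(t)}}\sqrt{\eta^{(t)}}\,\rho^{(t)}_{\max}\right)^2<\left(\sqrt{\epsilon+\big(C^{-1}(1/\delta)\big)^2}-C^{-1}(1/\delta)\right)^2=:\mathcal{R}_{dp}(\epsilon,\delta),$$ then the mechanism is $(\epsilon,\delta)$-differentially private with respect to the adversary's observations $\mathbf{y}_a=\{\mathbf{y}_a^{(t)}\}_{t=1}^T$, i.e. for every pair of neighboring global datasets $\mathcal{D},\mathcal{D}'$, $\mathrm{P}\big(|\mathcal{L}_{\mathcal{D},\mathcal{D}'}(\mathbf{y}_a)|\le\epsilon\big)\ge 1-\delta$.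
   Context: System: $K$ users, each with a local dataset $\mathcal{D}_k$ of $D$ data points $(\boldsymbol{\mu},\nu)$; global dataset $\mathcal{D}=\cup_k\mathcal{D}_k$. A model $\mathbf{w}\in\mathbb{R}^d$ is trained over rounds $t=1,\dots,T$; at round $t$ with current model $\mathbf{w}^{(t)}$, user $k$ computes the local gradient $\nabla F_k(\mathbf{w}^{(t)},\mathcal{D}_k)=\sum_{(\boldsymbol{\mu},\nu)\in\mathcal{D}_k}\nabla f(\mathbf{w}^{(t)},\boldsymbol{\mu},\nu)$ for a sample-wise loss $f$. User $k$ transmits $\mathbf{x}_k^{(t)}=\frac{\sqrt{\eta^{(t)}}}{h_k^{(t)}}\big(\nabla F_k(\mathbf{w}^{(t)},\mathcal{D}_k)+\mathbf{n}_k^{(t)}\big)$, where $h_k^{(t)}\in\mathbb{C}$ is its channel to the server and $\eta^{(t)}>0$ is a common power scaling factor. The perturbations are generated as the rows of $\mathbf{N}^{(t)}=(\mathbf{R}^{(t)})^{1/2}\mathbf{W}^{(t)}$, where $\mathbf{W}^{(t)}$ is a $K\times d$ matrix of i.i.d. $\mathcal{CN}(0,1)$ entries, independent across rounds, and $\mathbf{R}^{(t)}\succeq0$ is a $K\times K$ covariance matrix with $\sum_{k,j}\mathbf{R}^{(t)}_{k,j}=0$ (so $\sum_k\mathbf{n}_k^{(t)}=\mathbf{0}$). With $g_k^{(t)}\in\mathbb{C}$ the channel from user $k$ to the adversary and $\rho_k^{(t)}=g_k^{(t)}/h_k^{(t)}$, $\boldsymbol{\rho}^{(t)}=(\rho_1^{(t)},\dots,\rho_K^{(t)})^T$,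 the adversary receives $\mathbf{y}_a^{(t)}=\sqrt{\eta^{(t)}}\sum_k\rho_k^{(t)}\nabla F_k(\mathbf{w}^{(t)},\mathcal{D}_k)+\mathbf{r}^{(t)}$, where the effective noise $\mathbf{r}^{(t)}=\sqrt{\eta^{(t)}}\big((\boldsymbol{\rho}^{(t)})^T(\mathbf{R}^{(t)})^{1/2}\mathbf{W}^{(t)}\big)^T+\mathbf{z}_a^{(t)}$, with $\mathbf{z}_a^{(t)}\sim\mathcal{CN}(0,N_a\mathbf{I}_d)$ i.i.d. across rounds, is distributed as $\mathcal{CN}(0,(m^{(t)})^2\mathbf{I}_d)$, independent across rounds, with $(m^{(t)})^2=\eta^{(t)}(\boldsymbol{\rho}^{(t)})^T\mathbf{R}^{(t)}(\boldsymbol{\rho}^{(t)})^*+N_a$. Two global datasets $\mathcal{D}=\cup_k\mathcal{D}_k$, $\mathcal{D}'=\cup_k\mathcal{D}'_k$ are neighboring if for exactly one index $l$ the local datasets $\mathcal{D}_l,\mathcal{D}'_l$ differ in exactly one sample and $\mathcal{D}_k=\mathcal{D}'_k$ for $k\ne l$. The privacy loss is $\mathcal{L}_{\mathcal{D},\mathcal{D}'}(\mathbf{y}_a)=\ln\prod_{t=1}^T\frac{\mathrm{P}(\mathbf{y}_a^{(t)}\mid\mathbf{y}_a^{(1)},\dots,\mathbf{y}_a^{(t-1)},\mathcal{D})}{\mathrm{P}(\mathbf{y}_a^{(t)}\mid\mathbf{y}_a^{(1)},\dots,\mathbf{y}_a^{(t-1)},\mathcal{D}')}$, where the only randomness is the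 effective noise (the gradients at each round are treated as deterministic given the past). A mechanism is $(\epsilon,\delta)$-differentially private ($\epsilon\ge0$, $\delta\in[0,1]$) if $\mathrm{P}(|\mathcal{L}_{\mathcal{D},\mathcal{D}'}(\mathbf{y}_a)|\le\epsilon)\ge1-\delta$ for all neighboring $\mathcal{D},\mathcal{D}'$. *)

(* Defs.v *)
(* MathComp + MathComp-Analysis (R : realType), complex numbers R[i]
   from mathcomp-real-closed. *)
From HB Require Import structures.
From mathcomp Require Import all_boot all_order all_algebra.
From mathcomp Require Import all_classical all_reals all_analysis.
From mathcomp Require Import complex.
Set Implicit Arguments. Unset Strict Implicit. Unset Printing Implicit Defensive.
Import Order.TTheory GRing.Theory Num.Theory.
Local Open Scope ring_scope.
Local Open Scope classical_set_scope.

(* Euclidean norm of a real vector *)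
Definition eucl_norm {R : realType} {n : nat} (v : 'rV[R]_n) : R :=
  Num.sqrt (\sum_(j < n) v 0 j ^+ 2).

(* modulus of a complex number, and squared Euclidean norm of a complex vector *)
Definition cabs {R : realType} (z : R[i]) : R := Num.sqrt (complex.Re z ^+ 2 + complex.Im z ^+ 2).
Definition csqnorm {R : realType} {n : nat} (v : 'rV[R[i]]_n) : R :=
  \sum_(j < n) (complex.Re (v 0 j) ^+ 2 + complex.Im (v 0 j) ^+ 2).

(* embedding of a real vector into C^n *)
Definition cvec {R : realType} {n : nat} (v : 'rV[R]_n) : 'rV[R[i]]_n :=
  map_mx (fun x : R => complex.Complex x 0) v.

(* C(x) = sqrt(pi) x e^{x^2} and its inverse on (0, oo) *)
Definition C_fun {R : realType} (x : R) : R := Num.sqrt pi * x * expR (x ^+ 2).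
Definition C_inv {R : realType} (y : R) : R :=
  xget 0 [set x : R | 0 < x /\ C_fun x = y].

(* R_dp(eps, delta) *)
Definition R_dp {R : realType} (eps delta : R) : R :=
  (Num.sqrt (eps + C_inv delta^-1 ^+ 2) - C_inv delta^-1) ^+ 2.

(* Neighboring global datasets: global dataset = family of K local datasets
   (finite multisets, represented as sequences up to permutation). *)
Definition neighboring {S : eqType} {K : nat} (Dg Dg' : 'I_K -> seq S) : Prop :=
  exists l : 'I_K,
    (forall k : 'I_K, k != l -> Dg k = Dg' k) /\
    exists (s s' : S) (rest : seq S),
      s != s' /\ perm_eq (Dg l) (s :: rest) /\ perm_eq (Dg' l) (s' :: rest).

(* local gradient  nabla F_k(w, D_k) = sum_{(mu,nu) in D_k} nabla f(w, mu, nu) *)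
Definition local_grad {R : realType} {d : nat} {S : eqType}
  (f : 'rV[R]_d -> S -> 'rV[R]_d) (w : 'rV[R]_d) (Dk : seq S) : 'rV[R]_d :=
  \sum_(s <- Dk) f w s.

(* rho_k^(t) = g_k^(t) / h_k^(t) *)
Definition rho {R : realType} {T K : nat} (h g : 'I_T -> 'I_K -> R[i]) t k : R[i] :=
  g t k / h t k.

Definition rho_max {R : realType} {T K : nat} (h g : 'I_T -> 'I_K -> R[i]) t : R :=
  \big[Num.max/0]_(k < K) cabs (rho h g t k).

(* (m^(t))^2 = eta^(t) rho^T R rho^* + N_a, and m^(t) *)
Definition m_sq {R : realType} {T K : nat} (eta : 'I_T -> R)
  (h g : 'I_T -> 'I_K -> R[i]) (Rc : 'I_T -> 'M[R[i]]_K) (Na : R) t : R :=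
  eta t * complex.Re (\sum_(k < K) \sum_(j < K) rho h g t k * Rc t k j * (rho h g t j)^*) + Na.
Definition m_eff {R : realType} {T K : nat} (eta : 'I_T -> R)
  (h g : 'I_T -> 'I_K -> R[i]) (Rc : 'I_T -> 'M[R[i]]_K) (Na : R) t : R :=
  Num.sqrt (m_sq eta h g Rc Na t).

(* Hermitian positive semidefinite complex matrix: x^H A x is real >= 0 *)
Definition psd_c {R : realType} {K : nat} (A : 'M[R[i]]_K) : Prop :=
  forall x : 'I_K -> R[i], 0 <= \sum_(k < K) \sum_(j < K) (x k)^* * A k j * x j.

(* the family X of real random variables is i.i.d. standard normal:
   product rule on every box of Borel sets *)
Definition iid_std_normal {R : realType} {I : finType} {dm : measure_display}
  {Om : measurableType dm} (P : probability Om R) (X : I -> Om -> R) : Prop :=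
  (forall i, measurable_fun setT (X i)) /\
  forall B : I -> set R, (forall i, measurable (B i)) ->
    P (\bigcap_(i in [set: I]) (X i @^-1` B i)) =
    (\prod_(i : I) normal_prob 0 1 (B i))%E.

(* effective noise r^(t) ~ CN(0, m^2 I_d): real and imaginary parts of each
   coordinate are (m/sqrt 2) times independent standard normals *)
Definition eff_noise {R : realType} {dm : measure_display} {Om : measurableType dm}
  {T d : nat} (m : 'I_T -> R) (X : 'I_T * 'I_d * bool -> Om -> R) t (om : Om)
  : 'rV[R[i]]_d :=
  \row_(j < d) complex.Complex ((m t / Num.sqrt 2) * X (t, j, false) om)
                                ((m t / Num.sqrt 2) * X (t, j, true) om).

(* noiseless part of the adversary's signal at round t under global dataset Dg *)
Definition adv_mean {R : realType} {T K d : nat} {S : eqType}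
  (eta : 'I_T -> R) (h g : 'I_T -> 'I_K -> R[i])
  (f : 'rV[R]_d -> S -> 'rV[R]_d) (w : 'I_T -> 'rV[R]_d)
  (Dg : 'I_K -> seq S) t : 'rV[R[i]]_d :=
  \sum_(k < K) (complex.Complex (Num.sqrt (eta t)) 0 * rho h g t k) *: cvec (local_grad f (w t) (Dg k)).

(* density of CN(mean, m^2 I_d) on C^d *)
Definition cn_density {R : realType} {d : nat} (m : R) (mean y : 'rV[R[i]]_d) : R :=
  (pi * m ^+ 2) ^- d * expR (- csqnorm (y - mean) / m ^+ 2).

(* privacy loss L_{D,D'}(y_a) = ln prod_t P(y^(t) | past, D) / P(y^(t) | past, D') *)
Definition privacy_loss {R : realType} {T d : nat} (m : 'I_T -> R)
  (meanD meanD' : 'I_T -> 'rV[R[i]]_d) (y : 'I_T -> 'rV[R[i]]_d) : R :=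
  ln (\prod_(t < T) (cn_density (m t) (meanD t) (y t) / cn_density (m t) (meanD' t) (y t))).

(* Main.v *)
(* Writing v for the difference of the noiseless signals, the privacy loss is
   s + sqrt(2) Y with Y = sum_i a_i X_i, where the a_i are the real coordinates of
   the v^(t) / m^(t) and s = sum_i a_i^2. Stability of the normal law under
   independent sums makes the loss s + sqrt(2 s) Z with Z standard normal, so its
   modulus exceeds eps only if |Z| > sqrt(2) x with x = (eps - s) / (2 sqrt s).
   By the Mills bound P(|Z| > sqrt(2) x) <= 1 / C(x), and s < R_dp(eps, delta)
   amounts to x > C^-1(1/delta). Finally s is at most the sum in the hypothesis,
   since replacing one sample in user l moves the signal by
   sqrt(eta) rho_l (grad f(s) - grad f(s')). *)
Require Import Defs.
From HB Require Import structures.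
From mathcomp Require Import all_boot all_order all_algebra.
From mathcomp Require Import all_classical all_reals all_analysis.
From mathcomp Require Import measurable_realfun complex ring lra.
Import Order.TTheory GRing.Theory Num.Theory.
Import numFieldNormedType.Exports.
Local Open Scope ring_scope.
Local Open Scope classical_set_scope.

(** * Integration against a measure given by a density *)

Section density.
Local Open Scope ereal_scope.
Context d (T : measurableType d) (R : realType).
Variables mu nu : {measure set T -> \bar R}.
Import HBNNSimple.

(** Monotone convergence on both sides reduces to the simple approximations of [f], where the
    identity is the hypothesis on [nu] at the level sets, combined linearly. *)
Lemma ge0_integral_density (g : T -> R) :
  measurable_fun setT g -> (forall x, 0 <= g x)%R ->
  (forall A, measurable A -> nu A = \int[mu]_(x in A) (g x)%:E) ->
  forall f : T -> \bar R, measurable_fun setT f -> (forall x, 0 <= f x) ->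
  \int[nu]_x f x = \int[mu]_x (f x * (g x)%:E).
Proof.
move=> /measurable_EFinP mg g0 nuE f mf f0.
pose f_ := nnsfun_approx measurableT mf.
have f_cvg x : EFin \o f_^~ x @ \oo --> f x by exact: cvg_nnsfun_approx.
transitivity (limn (fun n => \int[nu]_x (f_ n x)%:E)).
  rewrite -monotone_convergence//.
  - by apply: eq_integral => y _; apply/esym/cvg_lim => //; exact: f_cvg.
  - by move=> n; exact/measurable_EFinP/measurable_funP.
  - by move=> n y _; rewrite lee_fin.
  - by move=> y _ m n mn; rewrite lee_fin; exact/lefP/nd_nnsfun_approx.
transitivity (limn (fun n => \int[mu]_x ((f_ n x)%:E * (g x)%:E))); last first.
  rewrite -monotone_convergence//.
  - apply: eq_integral => y _; apply/cvg_lim => //.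
    by apply: cvgeZr => //; exact: f_cvg.
  - by move=> n; apply: emeasurable_funM => //; exact/measurable_EFinP/measurable_funP.
  - by move=> n y _; rewrite mule_ge0// lee_fin.
  - move=> y _ m n mn; apply: lee_wpmul2r; rewrite lee_fin//.
    exact/lefP/nd_nnsfun_approx.
congr (limn _); apply/funext => n.
rewrite integral_nnsfun// sintegralE patch_setT.
transitivity (\int[mu]_x (\sum_(k \in range (f_ n))
    (k%:E * ((\1_(f_ n @^-1` [set k]) x)%:E * (g x)%:E)))); last first.
  apply: eq_integral => y _.
  rewrite [in RHS]fimfunE -fsumEFin// ge0_mule_fsuml.
    by apply: eq_fsbigr => k _; rewrite EFinM muleA.
  by move=> k; rewrite nnfun_muleindic_ge0.
rewrite ge0_integral_fsum//.
- apply: eq_fsbigr => k; rewrite inE => -[z _ <-].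
  rewrite ge0_integralZl//.
  + congr (_ * _); rewrite nuE// integral_mkcond; apply: eq_integral => y _.
    rewrite patchE indicE; case: ifPn => _; by rewrite ?mul1e ?mul0e.
  + apply: emeasurable_funM => //; exact/measurable_EFinP/measurable_indic.
  + by move=> y _; rewrite mule_ge0// lee_fin.
  + by rewrite lee_fin.
- move=> k; apply: emeasurable_funM => //; apply: emeasurable_funM => //.
  exact/measurable_EFinP/measurable_indic.
- move=> k y _; rewrite muleA; apply: mule_ge0; last by rewrite lee_fin.
  by rewrite -EFinM nnfun_muleindic_ge0.
Qed.

End density.

(** The pushforward bundled with its measure structure, taken from a proof of measurability passed
    as an argument. *)
Definition pushforward_measure {d d'} {T : measurableType d}
    {U : measurableType d'} {R : realType} (m : {measure set T -> \bar R})
    {f : T -> U} (mf : measurable_fun setT f) : {measure set U -> \bar R} :=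
  ltac:(refine (pushforward m f : {measure set U -> \bar R}); exact: mf).

Definition mfun_of {d d'} {T : measurableType d} {U : measurableType d'}
    {f : T -> U} (mf : measurable_fun setT f) : {mfun T >-> U} :=
  HB.pack f (isMeasurableFun.Build _ _ _ _ f mf).

(** * Affine changes of variable for Lebesgue measure and the normal law *)

Section normal_law.
Context {R : realType}.
Implicit Types (a b c m s x : R) (A : set R).
Local Notation MR := (measurableTypeR R).
Local Notation mu := (@lebesgue_measure R).

Lemma measurable_affine c b :
  @measurable_fun _ _ MR MR setT (fun x : R => c * x + b).
Proof.
suff : @measurable_fun _ _ R R setT (fun x : R => c * x + b) by [].
by apply: measurable_funD => //; exact: measurable_funM.
Qed.

(** Uniqueness of Lebesgue measure: the rescaled pushforward gives every half-open interval its
    length. *)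
Lemma lebesgue_measure_affine c b A : c != 0 -> measurable A ->
  (`|c|%:E * mu ((fun x => (c * x + b)%R) @^-1` A) = mu A)%E.
Proof.
move=> c0 mA; apply/esym.
pose m' : {measure set MR -> \bar R} :=
  mscale (NngNum (normr_ge0 c)) (pushforward_measure mu (measurable_affine c b)).
rewrite (_ : (_ * _)%E = m' A) //.
apply: lebesgue_measure_unique => //= _ [[u v]] _ <- /=.
rewrite /mscale /= /pushforward /=.
have [cn|cp|/eqP] := ltgtP c 0; last by rewrite (negbTE c0).
(* A negative slope swaps the endpoints and with them the closed side; the length formula does not
   see the latter. *)
- rewrite (_ : _ @^-1` _ = `[(v - b) / c, (u - b) / c[%classic); last first.
    apply/seteqP; split => x /=; rewrite !in_itv/= ler_ndivrMr// ltr_ndivlMr//;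
      by rewrite lerBrDr ltrBlDr mulrC andbC.
  rewrite !lebesgue_measure_itv/= !lte_fin ltr_ndivrMr// divfK// ltrD2r.
  case: ifP => _; last by rewrite mule0.
  by rewrite -!EFinB -EFinM ltr0_norm//; congr EFin; field.
- rewrite (_ : _ @^-1` _ = `](u - b) / c, (v - b) / c]%classic); last first.
    apply/seteqP; split => x /=; rewrite !in_itv/= ler_pdivlMr// ltr_pdivrMr//;
      by rewrite lerBrDr ltrBlDr mulrC.
  rewrite !lebesgue_measure_itv/= !lte_fin ltr_pdivrMr// divfK// ltrD2r.
  case: ifP => _; last by rewrite mule0.
  by rewrite -!EFinB -EFinM gtr0_norm//; congr EFin; field.
Qed.

Lemma normal_peakM c s : normal_peak (c * s) = `|c|^-1 * normal_peak s.
Proof.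
rewrite /normal_peak -invfM; congr (_^-1).
by rewrite exprMn -mulrA -mulrnAr sqrtrM ?sqr_ge0// sqrtr_sqr.
Qed.

Lemma normal_pdf_affine c b x : c != 0 ->
  normal_pdf 0 1 x = `|c| * normal_pdf b c (c * x + b).
Proof.
move=> c0; rewrite !normal_pdfE ?oner_eq0//= -[in normal_peak c](mulr1 c).
rewrite normal_peakM !mulrA divff ?normr_eq0// mul1r; congr (_ * _).
by rewrite /normal_fun; congr expR; field; rewrite c0.
Qed.

(** Change of variables: [normal_pdf_affine] brings out the Jacobian [|c|], which turns the
    pushforward of Lebesgue measure back into Lebesgue measure. *)
Lemma normal_prob_affine c b A : c != 0 -> measurable A ->
  normal_prob 0 1 ((fun x => c * x + b) @^-1` A) = normal_prob b c A.
Proof.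
move=> c0 mA; rewrite /normal_prob.
have mN : @measurable_fun _ _ MR _ setT (fun x => (normal_pdf b c x)%:E).
  by apply/measurable_EFinP; exact: measurable_normal_pdf.
have mphiA : measurable ((fun x => c * x + b) @^-1` A).
  by rewrite -[X in measurable X]setTI; exact: (measurable_affine c b measurableT).
under eq_integral do rewrite (normal_pdf_affine c b _ c0) EFinM.
rewrite ge0_integralZl//; last 2 first.
- apply: measurable_funTS; exact: (measurableT_comp mN (measurable_affine c b)).
- by move=> x _; rewrite lee_fin normal_pdf_ge0.
rewrite -(@ge0_integral_pushforward _ _ _ _ _ _ (measurable_affine c b) mu A
  (fun x => (normal_pdf b c x)%:E))//; last 2 first.
- exact: measurable_funTS.
- by move=> x _; rewrite lee_fin normal_pdf_ge0.
have f0 x : A x -> (0 <= (normal_pdf b c x)%:E)%E.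
  by move=> _; rewrite lee_fin normal_pdf_ge0.
pose mphi := pushforward_measure mu (measurable_affine c b).
rewrite -(@ge0_integral_mscale _ _ _ mphi _ mA (NngNum (normr_ge0 c)) _
  (measurable_funTS mN) f0).
apply: eq_measure_integral => //= B mB _.
by rewrite /mscale/= /pushforward/= lebesgue_measure_affine.
Qed.

End normal_law.

(** * Stability of the normal law under independent sums *)

Section normal_stability.
Context {R : realType}.
Implicit Types (a b c m s x : R) (A : set R).
Local Notation MR := (measurableTypeR R).
Local Notation mu := (@lebesgue_measure R).
Local Notation N := (@normal_prob R 0 1).

Lemma measurable_normal_prob_lin c A : measurable A ->
  measurable ((fun x : R => c * x) @^-1` A).
Proof.
move=> mA; have := measurable_affine c 0 measurableT A mA.
by rewrite setTI; under [X in _ (X @^-1` _) -> _]eq_fun do rewrite addr0.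
Qed.

Lemma normal_prob_lin c A : c != 0 -> measurable A ->
  N ((fun x => c * x) @^-1` A) = normal_prob 0 c A.
Proof.
move=> c0 mA; rewrite -(normal_prob_affine c 0)//.
by under [X in _ = normal_prob _ _ (X @^-1` _)]eq_fun do rewrite addr0.
Qed.

Lemma normal_pdfN m s x : normal_pdf m (- s) x = normal_pdf m s x.
Proof. by rewrite /normal_pdf oppr_eq0 /normal_peak /normal_fun sqrrN. Qed.

(** A sign change of the scale leaves the centred density unchanged. The value [c = 0] falls under
    the nonnegative case, which needs no density. *)
Lemma normal_prob_lin_abs c A : measurable A ->
  N ((fun x => c * x) @^-1` A) = N ((fun x => `|c| * x) @^-1` A).
Proof.
move=> mA; have [c0|c0] := leP 0 c; first by rewrite ger0_norm.
rewrite ltr0_norm// !normal_prob_lin ?oppr_eq0 ?lt_eqF//.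
by apply: eq_integral => x _; rewrite normal_pdfN.
Qed.

(* Completing the square in [u]: up to the marginal density of [w], the joint
   density of [(u, a u + b v)] is a normal density in [u]. *)
Lemma normal_pdf_cond a b (u w : R) : b != 0 ->
  let s := Num.sqrt (a ^+ 2 + b ^+ 2) in
  normal_pdf (a * u) b w * normal_pdf 0 1 u =
  normal_pdf 0 s w * normal_pdf (a * w / s ^+ 2) (b / s) u.
Proof.
move=> b0 s.
have S0 : 0 < a ^+ 2 + b ^+ 2 by rewrite ltr_wpDl ?sqr_ge0// exprn_even_gt0.
have s0 : s != 0 by rewrite gt_eqF// sqrtr_gt0.
have sE : s ^+ 2 = a ^+ 2 + b ^+ 2 by rewrite sqr_sqrtr// ltW.
rewrite !normal_pdfE ?mulf_neq0 ?invr_eq0 ?oner_eq0//= mulrACA [RHS]mulrACA.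
congr (_ * _).
  rewrite -[in normal_peak b](mulr1 b) -[in normal_peak s](mulr1 s).
  rewrite -[in normal_peak (b / s)](mulr1 (b / s)) !normal_peakM.
  by rewrite normrM normfV; field; rewrite !normr_eq0 b0 s0.
rewrite /normal_fun -!expRD; congr expR.
by rewrite expr_div_n sE; field; rewrite b0 gt_eqF.
Qed.

Lemma measurable_normal_pdf2 a b : b != 0 ->
  @measurable_fun _ _ (MR * MR)%type R setT
    (fun p => normal_pdf (a * p.1) b p.2).
Proof.
move=> b0; under eq_fun do rewrite normal_pdfE//.
apply: measurable_funM => //; apply: measurableT_comp => //.
apply: measurable_funM => //; apply: measurableT_comp => //.
apply: measurable_funX; apply: measurable_funB.
- exact: (@measurable_snd _ _ MR MR).
- by apply: measurable_funM => //; exact: (@measurable_fst _ _ MR MR).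
Qed.

Lemma normal_prob_conv a b A : measurable A ->
  (\int[N]_u N ((fun v => (a * u + b * v)%R) @^-1` A) =
   N ((fun x => (Num.sqrt (a ^+ 2 + b ^+ 2) * x)%R) @^-1` A))%E.
Proof.
(* For [b = 0] there is no density in [v]: the inner event is everything or empty, and the integrand
   is an indicator. *)
move=> mA; have [->|b0] := eqVneq b 0.
  rewrite expr0n addr0 sqrtr_sqr -normal_prob_lin_abs//.
  have mB := measurable_normal_prob_lin a A mA.
  transitivity (\int[N]_u (\1_((fun x => (a * x)%R) @^-1` A) u)%:E)%E.
    apply: eq_integral => u _.
    under [X in N (X @^-1` _)]eq_fun do rewrite mul0r addr0.
    rewrite indicE; have [uA|uA] := boolP (u \in _).
      rewrite (_ : _ @^-1` A = setT); first exact: probability_setT.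
      by apply/seteqP; split => // x _; move: uA; rewrite inE.
    rewrite (_ : _ @^-1` A = set0) ?measure0//.
    by apply/seteqP; split => // x /=; move: uA; rewrite notin_setE.
  by rewrite integral_indic// setIT.
set s := Num.sqrt _.
have s0 : s != 0.
  by rewrite gt_eqF// sqrtr_gt0 ltr_wpDl ?sqr_ge0// exprn_even_gt0.
(* For fixed [u], the variable [a u + b v] has density [normal_pdf (a * u) b]; [f] is this density
   restricted to [A]. *)
pose f (p : MR * MR) := (normal_pdf (a * p.1) b p.2 * \1_A p.2)%:E.
have mf : measurable_fun setT f.
  apply/measurable_EFinP; apply: measurable_funM.
    exact: measurable_normal_pdf2.
  apply: (@measurableT_comp _ _ _ _ MR _ (\1_A : MR -> R)).
    exact: measurable_indic.
  exact: (@measurable_snd _ _ MR MR).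
have f0 p : (0 <= f p)%E by rewrite lee_fin mulr_ge0 ?normal_pdf_ge0.
transitivity (\int[N]_u \int[mu]_w f (u, w))%E.
  apply: eq_integral => u _.
  under [X in N (X @^-1` _)]eq_fun do rewrite addrC.
  rewrite normal_prob_affine// /normal_prob integral_mkcond.
  apply: eq_integral => w _; rewrite patchE /f indicE/=.
  by case: ifPn => _; rewrite ?mulr1 ?mulr0.
rewrite (fubini_tonelli f)// normal_prob_lin// /normal_prob [RHS]integral_mkcond.
apply: eq_integral => w _.
have mfw : measurable_fun setT (fun u => f (u, w)).
  apply: (measurableT_comp mf (g := fun u : MR => (u, w))).
  exact: pair2_measurable.
have mg : @measurable_fun _ _ MR R setT (normal_pdf 0 1).
  exact: measurable_normal_pdf.
rewrite (@ge0_integral_density _ _ _ mu N (normal_pdf 0 1) mg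
  (normal_pdf_ge0 0 1) (fun _ _ => erefl) _ mfw)//.
(* For fixed [w], what depends on [u] after completing the square is a normal density, of integral
   1. *)
transitivity (\int[mu]_u ((normal_pdf 0 s w * \1_A w)%:E *
    (normal_pdf (a * w / s ^+ 2) (b / s) u)%:E))%E.
  apply: eq_integral => u _; rewrite -!EFinM; congr EFin.
  by rewrite mulrAC normal_pdf_cond// mulrAC.
have mh : @measurable_fun _ _ MR _ setT
    (fun u => (normal_pdf (a * w / s ^+ 2) (b / s) u)%:E).
  by apply/measurable_EFinP; exact: measurable_normal_pdf.
rewrite (ge0_integralZl _ measurableT mh); last 2 first.
- by move=> u _; rewrite lee_fin normal_pdf_ge0.
- by rewrite lee_fin mulr_ge0 ?normal_pdf_ge0.
rewrite integral_normal_pdf mule1 patchE indicE.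
by case: ifPn => _; rewrite ?mulr1 ?mulr0.
Qed.

End normal_stability.

(** * The Mills bound for the normal tail *)

Section normal_tail.
Context {R : realType}.
Implicit Types (x t : R).
Local Notation mu := (@lebesgue_measure R).
Local Notation N := (@normal_prob R 0 1).

Lemma std_normal_pdfE x :
  normal_pdf 0 1 x = normal_peak 1 * expR (- (2^-1 * x ^+ 2)).
Proof.
rewrite normal_pdfE ?oner_eq0//; congr (_ * _); rewrite /normal_fun.
by congr expR; field.
Qed.

Lemma std_normal_peakE : normal_peak (1 : R) = (Num.sqrt 2 * Num.sqrt pi)^-1.
Proof.
by rewrite /normal_peak expr1n mul1r -mulr_natl sqrtrM.
Qed.

Lemma is_derive_std_normal_pdf x :
  is_derive x 1 (normal_pdf 0 1 : R -> R) (- (x * normal_pdf 0 1 x)).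
Proof.
rewrite (_ : normal_pdf 0 1 = normal_peak 1 *: (expR \o (fun y => - (2^-1 * y ^+ 2)))).
  apply: is_derive_eq; rewrite /= /GRing.scale /=.
  set e := expR _; set p := normal_peak _.
  by rewrite -[p *: e]/(p * e); field.
by apply/funext => y; rewrite std_normal_pdfE.
Qed.

Lemma cvg_std_normal_pdf : (normal_pdf 0 1 : R -> R) x @[x --> +oo] --> (0 : R).
Proof.
rewrite (_ : normal_pdf 0 1 = fun x => normal_peak 1 * expR (- (x ^+ 2 * 2^-1))).
  rewrite -[X in _ --> X](mulr0 (normal_peak 1)).
  apply: cvgM; first exact: cvg_cst.
  apply: (cvg_comp (fun x => x ^+ 2 * 2^-1) (fun x => expR (- x))).
    by apply: gt0_cvgMly => //; exact: cvgr_expr2.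
  exact: cvgr_expR.
by apply/funext => x; rewrite std_normal_pdfE mulrC (mulrC _ 2^-1) mulrC.
Qed.

(** On the half-line [x / t] is at least 1, and [x] times the density is minus its derivative, so
    the enlarged integrand has an explicit antiderivative vanishing at infinity. *)
Lemma normal_prob_itvcy_le t : 0 < t ->
  (N `[t, +oo[%classic <= (normal_pdf 0 1 t / t)%:E)%E.
Proof.
move=> t0; rewrite /normal_prob.
have cpdf : continuous (normal_pdf (0 : R) 1).
  by apply: continuous_normal_pdf; rewrite oner_eq0.
have cf : continuous (fun x : R => t^-1 * (x * normal_pdf 0 1 x)).
  move=> x; apply: cvgM; first exact: cvg_cst.
  by apply: cvgM; [exact: cvg_id|exact: cpdf].
have -> : ((normal_pdf 0 1 t / t)%:E =
    \int[mu]_(x in `[t, +oo[) (t^-1 * (x * normal_pdf 0 1 x))%:E)%E.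
  rewrite (@ge0_continuous_FTC2y _ _ (fun x => - t^-1 * normal_pdf 0 1 x) t 0).
  - by rewrite sub0e -EFinN mulNr opprK mulrC.
  - move=> x tx; have x0 := le_trans (ltW t0) tx.
    by rewrite !mulr_ge0 ?normal_pdf_ge0// invr_ge0 ltW.
  - exact: continuous_subspaceT.
  - rewrite -[X in _ --> X](mulr0 (- t^-1)).
    by apply: cvgM; [exact: cvg_cst|exact: cvg_std_normal_pdf].
  - move=> x _; apply: derivableM => //.
    exact: (@ex_derive _ _ _ _ _ _ _ (is_derive_std_normal_pdf x)).
  - apply: cvg_at_right_filter.
    by apply: cvgM; [exact: cvg_cst|exact: cpdf].
  - move=> x _; have dx := is_derive_std_normal_pdf x.
    have -> : (fun x => - t^-1 * normal_pdf 0 1 x) = - t^-1 *: normal_pdf 0 1 by [].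
    by rewrite derive1E derive_val /GRing.scale/= mulrNN.
apply: ge0_le_integral => //.
- by move=> x _; rewrite lee_fin normal_pdf_ge0.
- apply: measurable_funTS; apply/measurable_EFinP; exact: measurable_normal_pdf.
- apply: measurable_funTS; apply/measurable_EFinP; exact: continuous_measurable_fun.
- move=> x /=; rewrite in_itv/= andbT => tx.
  by rewrite lee_fin mulrA ler_peMl ?normal_pdf_ge0// mulrC ler_pdivlMr ?mul1r.
Qed.

(** Two one-sided Mills bounds at [t = sqrt 2 * x]: twice the density at [t] over [t] is exactly
    [1 / C_fun x]. *)
Lemma normal_prob_tail x : 0 < x ->
  (N [set z | (Num.sqrt 2 * x < `|z|)%R] <= ((C_fun x)^-1)%:E)%E.
Proof.
move=> x0; have t0 : 0 < Num.sqrt 2 * x by rewrite mulr_gt0 ?sqrtr_gt0.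
pose t := Num.sqrt 2 * x; rewrite -/t in t0 *.
pose I : set R := `[t, +oo[%classic.
have mI : measurable I by exact: measurable_itv.
have mIN : measurable ((fun z => -1 * z) @^-1` I).
  exact: measurable_normal_prob_lin.
have -> : [set z : R | t < `|z|] = `]t, +oo[%classic `|` (fun z => -1 * z) @^-1` `]t, +oo[%classic.
  apply/seteqP; split => z /=; rewrite !in_itv/= !andbT mulN1r lter_normr => /orP//.
(* The open half-lines are enlarged to closed ones, the form of the one-sided bound. *)
apply: (@le_trans _ _ (N I + N ((fun z => -1 * z)%R @^-1` I))%E).
  have mJ : measurable (`]t, +oo[%classic : set R) by exact: measurable_itv.
  have mJN := measurable_normal_prob_lin (-1) _ mJ.
  apply: (le_trans (measureU2 N mJ mJN)); apply: leeD.
  - apply: le_measure; [exact: mem_set mJ|exact: mem_set mI|].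
    by apply: subset_itvr; rewrite bnd_simp.
  - apply: le_measure; [exact: mem_set mJN|exact: mem_set mIN|].
    by apply: preimage_subset; apply: subset_itvr; rewrite bnd_simp.
rewrite normal_prob_lin_abs// normrN1.
under [X in (_ + N (X @^-1` _))%E]eq_fun do rewrite mul1r.
have := normal_prob_itvcy_le t t0; rewrite -/I => NI.
apply: (le_trans (leeD NI NI)); rewrite -EFinD lee_fin.
rewrite std_normal_pdfE std_normal_peakE /t /C_fun exprMn sqr_sqrtr// mulrA.
rewrite mulVf// mul1r expRN.
set p := Num.sqrt pi; have p0 : p != 0 by rewrite gt_eqF// sqrtr_gt0 pi_gt0.
have r0 : Num.sqrt 2 != 0 :> R by rewrite gt_eqF// sqrtr_gt0.
rewrite le_eqVlt; apply/orP; left; apply/eqP.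
have -> : forall y : R, y + y = Num.sqrt 2 ^+ 2 * y.
  by move=> y; rewrite sqr_sqrtr// mulr_natl mulr2n.
have x1 : x != 0 by rewrite gt_eqF.
have e1 : expR (x ^+ 2) != 0 by rewrite gt_eqF// expR_gt0.
by field; do ?[apply/andP; split].
Qed.

End normal_tail.

(** * Linear combinations of the i.i.d. standard normals *)

Section normal_sum.
Context {R : realType} {I : finType} {dm : measure_display}.
Context {Om : measurableType dm} (P : probability Om R) (X : I -> Om -> R).
Hypothesis Xiid : iid_std_normal P X.
Local Notation MR := (measurableTypeR R).
Local Notation N := (@normal_prob R 0 1).
Variable a : I -> R.

Lemma measurable_lin_comb (r : seq I) :
  measurable_fun setT (fun om => \sum_(i <- r) a i * X i om).
Proof.
by apply: measurable_sum => i; apply: measurable_funM => //; exact: Xiid.1.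
Qed.

Let rest (r : seq I) (B : I -> set R) : set Om :=
  \bigcap_(i in [set i | i \notin r]) (X i @^-1` B i).

Let measurable_rest r B : (forall i, measurable (B i)) -> measurable (rest r B).
Proof.
move=> mB; apply: fin_bigcap_measurable; first exact: finite_finset.
move=> i _; rewrite -[X in measurable X]setTI; exact: Xiid.1.
Qed.

(* The events on the unused variables are carried along because the hypothesis
   is a product rule on boxes only: the pair of the partial sum and the next
   variable, restricted to these events, is then a scaled product measure.
   The law of the sum is written as that of [s Z] with [Z] standard normal, since
   for [s = 0] the term [normal_prob 0 0] is the uniform law on [0, 1]. *)
Lemma lin_comb_normal_rest (r : seq I) : uniq r ->
  forall A B, measurable A -> (forall i, measurable (B i)) ->
  (P ((fun om => (\sum_(i <- r) a i * X i om)%R) @^-1` A `&` rest r B) =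
   N ((fun x => (Num.sqrt (\sum_(i <- r) a i ^+ 2) * x)%R) @^-1` A) *
   \prod_(i | i \notin r) N (B i))%E.
Proof.
elim: r => [_|j r IH /= /andP[jr ur]] A B mA mB.
  have -> : rest [::] B = \bigcap_(i in [set: I]) (X i @^-1` B i).
    by rewrite /rest (_ : [set i | i \notin [::]] = [set: I])//; apply/seteqP; split.
  (* The empty sum is constantly 0, so both preimages of [A] are everything or empty according to
     whether [A] contains 0. *)
  have [A0|A0] := pselect (A 0).
    rewrite (_ : _ @^-1` A = setT) ?setTI; last first.
      by apply/seteqP; split => // om _ /=; rewrite big_nil.
    rewrite (_ : _ @^-1` A = setT) ?probability_setT ?mul1e ?Xiid.2//; last first.
      by apply/seteqP; split => // x _ /=; rewrite big_nil sqrtr0 mul0r.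
  rewrite (_ : _ @^-1` A = set0) ?set0I; last first.
    by apply/seteqP; split => // om /=; rewrite big_nil.
  rewrite (_ : _ @^-1` A = set0) ?measure0 ?mul0e//; last first.
  by apply/seteqP; split => // x /=; rewrite big_nil sqrtr0 mul0r.
set S := fun om => \sum_(i <- r) a i * X i om.
set s := Num.sqrt (\sum_(i <- r) a i ^+ 2).
pose c := (\prod_(i | i \notin j :: r) N (B i))%E.
have cfin : c \is a fin_num.
  by apply: prode_fin_num => i _; apply: fin_num_measure; exact: mB.
have c0 : (0 <= c)%E by apply: prode_ge0 => i _; exact: measure_ge0.
have c0' : 0 <= fine c by exact: fine_ge0.
have mS : @measurable_fun _ _ Om MR setT S by exact: measurable_lin_comb.
pose Phi om : MR * MR := (S om, X j om).
have mPhi : measurable_fun setT Phi.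
  by apply: measurable_fun_pair => //; exact: Xiid.1.
have mrest := measurable_rest (j :: r) B mB.
pose m' := pushforward_measure (mrestr P mrest) mPhi.
pose m1 := distribution N (mfun_of (measurable_affine s 0)).
pose m2 := mscale (NngNum c0') N.
have mboxE (A1 A2 : set MR) : measurable A1 -> measurable A2 ->
    m' (A1 `*` A2) = (m1 A1 * m2 A2)%E.
  (* With [A2] as the event for the variable [j], the induction hypothesis for [r] computes the
     measure of the box. *)
  move=> mA1 mA2; pose B' i : set R := if i == j then A2 else B i.
  have mB' i : measurable (B' i : set R).
    by rewrite /B'; case: ifP => _; [exact: mA2|exact: mB].
  transitivity (P (S @^-1` A1 `&` rest r B')).
    congr (P _); apply/seteqP; split => om /=.
    - move=> [[SA XA] omB]; split=> // i /= ir; rewrite /B'.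
      by case: eqP => [->//|/eqP ij]; apply: omB; rewrite /= inE negb_or ij.
    - move=> [SA omB]; split; first split => //.
      + by have /= := omB j jr; rewrite /B' eqxx.
      + move=> i /=; rewrite inE negb_or => /andP[ij ir].
        by have /= := omB i ir; rewrite /B' (negbTE ij).
  rewrite IH// (bigD1 j)//= {1}/B' eqxx /m2 /mscale /= fineK//.
  congr (_ * _)%E.
    rewrite /m1 /distribution /pushforward /=.
    by under [X in _ = N (X @^-1` _)]eq_fun do rewrite addr0.
  rewrite muleC; congr (_ * _)%E; apply: eq_big => [i|i /andP[_ ij]].
    by rewrite inE negb_or andbC.
  by rewrite /B' (negbTE ij).
have mlin (u v : R) : @measurable_fun _ _ (MR * MR)%type MR setT
    (fun p => u * p.1 + v * p.2).
  suff : @measurable_fun _ _ (MR * MR)%type R setT (fun p => u * p.1 + v * p.2) by [].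
  apply: measurable_funD.
    by apply: measurable_funM => //; exact: (@measurable_fst _ _ MR MR).
  by apply: measurable_funM => //; exact: (@measurable_snd _ _ MR MR).
pose E (u v : R) : set (MR * MR) := (fun p => u * p.1 + v * p.2) @^-1` A.
have mE u v : measurable (E u v).
  by rewrite -[X in measurable X]setTI; exact: mlin.
have xE u v x : xsection (E u v) x = (fun y => u * x + v * y) @^-1` A.
  by apply/seteqP; split => y; rewrite /xsection /= ?inE.
have -> : P ((fun om => \sum_(i <- j :: r) a i * X i om) @^-1` A
    `&` rest (j :: r) B) = m' (E 1 (a j)).
  congr (P (_ `&` _)); apply/seteqP; split => om;
    by rewrite /Phi /E /= big_cons mul1r addrC.
(* Agreement on boxes determines the measure, so the event on the new sum can be measured through
   its sections. *)
rewrite -(@product_measure_unique _ _ MR MR R m1 m2 m' mboxE _ (mE 1 (a j))).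
rewrite /product_measure1 /m1 ge0_integral_distribution//; last first.
  exact: measurable_fun_xsection.
transitivity (\int[N]_u (c * N ((fun v => (s * u + a j * v)%R) @^-1` A)))%E.
  apply: eq_integral => u _; rewrite /= xE /m2 /mscale /= fineK//.
  by rewrite mul1r addr0.
rewrite ge0_integralZl//; last first.
  have := @measurable_fun_xsection _ _ MR MR R N _ (mE s (a j)).
  by rewrite /comp; under eq_fun do rewrite xE.
rewrite normal_prob_conv// muleC.
by rewrite sqr_sqrtr ?big_cons 1?(addrC (a j ^+ 2))// sumr_ge0// => i _; rewrite sqr_ge0.
Qed.

Lemma lin_comb_normal A : measurable A ->
  P ((fun om => \sum_(i : I) a i * X i om) @^-1` A) =
  N ((fun x => Num.sqrt (\sum_(i : I) a i ^+ 2) * x) @^-1` A).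
Proof.
move=> mA.
have := lin_comb_normal_rest (index_enum I) (index_enum_uniq I) A
  (fun=> setT) mA (fun=> measurableT).
rewrite [X in (_ * X)%E]big1 ?mule1 => [|i _]; last exact: probability_setT.
by rewrite (_ : rest _ _ = setT) ?setIT//; apply/seteqP; split.
Qed.

End normal_sum.

(** * The function [C_fun], its inverse, and the threshold [R_dp] *)

Section C_inv.
Context {R : realType}.
Implicit Types (x y c s eps delta : R).

Lemma C_fun_gt0 x : 0 < x -> 0 < C_fun x.
Proof. by move=> x0; rewrite !mulr_gt0 ?expR_gt0// sqrtr_gt0 pi_gt0. Qed.

Lemma ler_C_fun x y : 0 < x -> x <= y -> C_fun x <= C_fun y.
Proof.
move=> x0 xy; have y0 := lt_le_trans x0 xy.
rewrite /C_fun -!mulrA ler_wpM2l ?sqrtr_ge0//.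
rewrite ler_pM ?expR_ge0 ?(ltW x0)// ler_expR.
by rewrite ler_pXn2r// nnegrE ltW.
Qed.

(** Intermediate values on [[0, y]]: [C_fun] vanishes at 0 and is at least [y] at [y], because
    [sqrt pi] and the exponential factor are at least 1. The default value of [xget] is thus never
    taken. *)
Lemma C_invP y : 0 < y -> 0 < C_inv y /\ C_fun (C_inv y) = y.
Proof.
move=> y0.
have p1 : 1 <= Num.sqrt (pi : R).
  by rewrite -[leLHS]sqrtr1 ler_sqrt ?pi_gt0// (le_trans _ (pi_ge2 R))// ler1n.
have cC : continuous (C_fun : R -> R).
  move=> x; apply: cvgM.
    by apply: cvgM; [exact: cvg_cst|exact: cvg_id].
  apply: (cvg_comp (fun x => x ^+ 2) expR); first exact: sqr_continuous.
  exact: continuous_expR.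
have C0 : C_fun (0 : R) = 0 by rewrite /C_fun mulr0 mul0r.
have yC : y <= C_fun y.
  rewrite /C_fun mulrAC ler_peMl ?(ltW y0)// mulr_ege1// -expR0 ler_expR.
  exact: sqr_ge0.
have [|||x xy Cx] := @IVT R C_fun 0 y y; first exact: ltW.
- exact: continuous_subspaceT.
- by rewrite C0 ge_min le_max ltW// yC orbT.
apply: (@xgetPex _ 0 [set x : R | 0 < x /\ C_fun x = y]); exists x; split=> //.
move: xy; rewrite in_itv/= le_eqVlt => /andP[/orP[/eqP x0|//] _].
by move: y0; rewrite -Cx -x0 C0 ltxx.
Qed.

(** With [r = sqrt s] and [q ^+ 2 = eps + c ^+ 2], the hypothesis says [r + c < q]; squaring gives
    the claim. This form avoids dividing by [r], so it covers [s = 0]. *)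
Lemma lt_R_dp eps delta s : 0 < delta -> 0 <= eps -> 0 <= s ->
  s < R_dp eps delta -> s + 2 * C_inv delta^-1 * Num.sqrt s < eps.
Proof.
move=> d0 e0 s0; rewrite /R_dp; set c := C_inv _; set q := Num.sqrt (eps + _).
have [c0 _] : 0 < c /\ _ := C_invP _ (etrans (invr_gt0 delta) d0).
have cq : c <= q.
  by rewrite -[leLHS](gtr0_norm c0) -sqrtr_sqr; apply: ler_wsqrtr; rewrite lerDr.
rewrite -{1}(sqr_sqrtr s0) => h.
have {}h : Num.sqrt s < q - c by rewrite -ltr_sqr ?nnegrE ?subr_ge0 ?sqrtr_ge0.
have q2 : q ^+ 2 = eps + c ^+ 2 by rewrite sqr_sqrtr// addr_ge0// sqr_ge0.
have r0 := sqrtr_ge0 s.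
rewrite -{1}(sqr_sqrtr s0); set r := Num.sqrt s in h r0 *.
nra.
Qed.

End C_inv.

(** * The privacy loss as an affine form in the standard normals *)

Section loss.
Context {R : realType}.

Lemma ln_prod_expR (n : nat) (F : 'I_n -> R) :
  ln (\prod_(t < n) expR (F t)) = \sum_(t < n) F t.
Proof. by rewrite -expR_sum expRK. Qed.

(** The normalizing constants cancel; with [w = u - v] the exponent is the difference of the squared
    norms of [w + n] and [n], over [m ^+ 2], expanded by coordinates. *)
Lemma cn_density_ratio d (m : R) (u v n : 'rV[R[i]]_d) : 0 < m ->
  cn_density m u (u + n) / cn_density m v (u + n) =
  expR (\sum_(j < d) ((complex.Re ((u - v) 0 j) ^+ 2 + complex.Im ((u - v) 0 j) ^+ 2
     + 2 * (complex.Re ((u - v) 0 j) * complex.Re (n 0 j)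
          + complex.Im ((u - v) 0 j) * complex.Im (n 0 j))) / m ^+ 2)).
Proof.
move=> m0; have k0 : (pi * m ^+ 2) ^- d != 0.
  by rewrite invr_eq0 expf_neq0// gt_eqF// mulr_gt0 ?pi_gt0 ?exprn_gt0.
rewrite /cn_density; set k := _ ^- d in k0 *; rewrite (invfM k) mulrACA divff// mul1r -expRN -expRD; congr expR.
rewrite addrAC subrr add0r (_ : u + n - v = (u - v) + n); last by rewrite addrAC.
move: (u - v) => w; rewrite !mulNr opprK addrC -mulrBl -mulr_suml /csqnorm -sumrB.
congr (_ * _); apply: eq_bigr => j _; rewrite !mxE.
by case: (w 0 j) => a b; case: (n 0 j) => e f /=; ring.
Qed.

Lemma big_triple (T d : nat) (F : 'I_T * 'I_d * bool -> R) :
  \sum_i F i = \sum_(t < T) \sum_(j < d) (F (t, j, false) + F (t, j, true)).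
Proof.
rewrite pair_bigA /=; transitivity (\sum_(p : 'I_T * 'I_d) \sum_(b : bool) F (p, b)).
  by rewrite pair_bigA; apply: eq_bigr => -[].
by apply: eq_bigr => -[t j] _; rewrite big_bool addrC.
Qed.

(** The coefficients [a_i] of the loss, indexed like the standard normals that drive the noise. *)
Definition mean_shift (T d : nat) (m : 'I_T -> R) (v : 'I_T -> 'rV[R[i]]_d)
    (i : 'I_T * 'I_d * bool) : R :=
  (if i.2 then complex.Im (v i.1.1 0 i.1.2) else complex.Re (v i.1.1 0 i.1.2))
  / m i.1.1.

Lemma sum_mean_shift_sqr (T d : nat) (m : 'I_T -> R) (v : 'I_T -> 'rV[R[i]]_d) :
  \sum_i mean_shift T d m v i ^+ 2 = \sum_(t < T) csqnorm (v t) / m t ^+ 2.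
Proof.
rewrite big_triple; apply: eq_bigr => t _; rewrite mulr_suml; apply: eq_bigr => j _.
by rewrite /mean_shift/= !expr_div_n mulrDl.
Qed.

Lemma privacy_lossE (T d : nat) (dm : measure_display) (Om : measurableType dm)
    (X : 'I_T * 'I_d * bool -> Om -> R) (m : 'I_T -> R)
    (u v : 'I_T -> 'rV[R[i]]_d) om : (forall t, 0 < m t) ->
  let a := mean_shift T d m (fun t => u t - v t) in
  privacy_loss m u v (fun t => u t + eff_noise m X t om) =
  \sum_i a i ^+ 2 + Num.sqrt 2 * \sum_i a i * X i om.
Proof.
move=> m0 a; rewrite /privacy_loss.
under eq_bigr => t _ do rewrite cn_density_ratio//.
rewrite ln_prod_expR !big_triple mulr_sumr -big_split; apply: eq_bigr => t _.
rewrite mulr_sumr -big_split; apply: eq_bigr => j _.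
have r0 : Num.sqrt 2 != 0 :> R by rewrite gt_eqF// sqrtr_gt0.
(* The 2 of the cross term must cancel against the noise scale [m t / Num.sqrt 2], leaving one
   factor [Num.sqrt 2]; writing it as a square makes this visible to [field]. *)
have -> : 2 = Num.sqrt 2 ^+ 2 :> R by rewrite sqr_sqrtr.
rewrite /a /mean_shift /eff_noise !mxE /=; case: (u t 0 j) => ? ?; case: (v t 0 j) => ? ?.
by rewrite /= sqrtr_sqr gtr0_norm ?sqrtr_gt0//; field; rewrite r0 gt_eqF.
Qed.

End loss.

(** * Sensitivity of the noiseless signal to one sample *)

Section sensitivity.
Context {R : realType}.

Lemma csqnorm_scale_cvec d (z : R[i]) (u : 'rV[R]_d) :
  csqnorm (z *: cvec u) = cabs z ^+ 2 * eucl_norm u ^+ 2.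
Proof.
rewrite !sqr_sqrtr ?addr_ge0 ?sqr_ge0//; last by apply: sumr_ge0 => j _; exact: sqr_ge0.
rewrite mulr_sumr; apply: eq_bigr => j _; rewrite !mxE.
by case: z => a b /=; ring.
Qed.

(** Coordinatewise, [(x - y)^2] is at most [2 (x^2 + y^2)]; summing gives the bound [4 c^2] without
    the triangle inequality. *)
Lemma eucl_normB_sqr_le d (u v : 'rV[R]_d) c :
  eucl_norm u <= c -> eucl_norm v <= c -> eucl_norm (u - v) ^+ 2 <= (2 * c) ^+ 2.
Proof.
have nn (w : 'rV[R]_d) : 0 <= \sum_(j < d) w 0 j ^+ 2.
  by apply: sumr_ge0 => j _; exact: sqr_ge0.
have sq w : eucl_norm w <= c -> \sum_(j < d) w 0 j ^+ 2 <= c ^+ 2.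
  move=> wc; rewrite -(sqr_sqrtr (nn w)) ler_pXn2r// nnegrE ?sqrtr_ge0//.
  exact: le_trans (sqrtr_ge0 _) wc.
move=> /sq uc /sq vc; rewrite sqr_sqrtr//.
apply: (@le_trans _ _ (2 * (\sum_(j < d) u 0 j ^+ 2 + \sum_(j < d) v 0 j ^+ 2))).
  rewrite -big_split mulr_sumr; apply: ler_sum => j _; rewrite !mxE.
  by have := sqr_ge0 (u 0 j + v 0 j); rewrite -subr_ge0 /=; lra.
by rewrite exprMn; lra.
Qed.

Lemma cabs_scale (r : R) (z : R[i]) :
  cabs (complex.Complex r 0 * z) ^+ 2 = r ^+ 2 * cabs z ^+ 2.
Proof.
rewrite !sqr_sqrtr ?addr_ge0 ?sqr_ge0//.
by case: z => a b /=; ring.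
Qed.

Lemma cvecB d (u v : 'rV[R]_d) : cvec u - cvec v = cvec (u - v).
Proof. by apply/rowP => j; rewrite !mxE /GRing.opp /GRing.add /= subr0. Qed.

Lemma rho_max_ge (T K : nat) (h g : 'I_T -> 'I_K -> R[i]) t k :
  cabs (rho h g t k) <= rho_max h g t.
Proof. by rewrite /rho_max (bigD1 k)//= le_max lexx. Qed.

(** Unchanged users and common samples cancel. The datasets do not vary with the round, so one user
    and one pair of samples serve all rounds. *)
Lemma adv_mean_neighboring (T K d : nat) (S : eqType) (eta : 'I_T -> R)
    (h g : 'I_T -> 'I_K -> R[i]) (f : 'rV[R]_d -> S -> 'rV[R]_d) w
    (Dg Dg' : 'I_K -> seq S) : neighboring Dg Dg' ->
  exists l s s', forall t,
    adv_mean eta h g f w Dg t - adv_mean eta h g f w Dg' t =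
    (complex.Complex (Num.sqrt (eta t)) 0 * rho h g t l)
      *: cvec (f (w t) s - f (w t) s').
Proof.
move=> [l [Dl [s [s' [rs [_ [ps ps']]]]]]]; exists l, s, s' => t.
rewrite /adv_mean -sumrB (bigD1 l)//= big1 ?addr0 => [|k /Dl ->]; last first.
  by rewrite subrr.
rewrite -scalerBr cvecB /local_grad (perm_big _ ps) (perm_big _ ps') !big_cons.
by rewrite opprD addrACA subrr addr0.
Qed.

Lemma csqnorm_adv_mean_le (T K d : nat) (S : eqType) (eta : 'I_T -> R)
    (h g : 'I_T -> 'I_K -> R[i]) (f : 'rV[R]_d -> S -> 'rV[R]_d) w gamma
    (Dg Dg' : 'I_K -> seq S) :
  (forall t (s : S), eucl_norm (f (w t) s) <= gamma t) ->
  neighboring Dg Dg' -> forall t,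
  csqnorm (adv_mean eta h g f w Dg t - adv_mean eta h g f w Dg' t) <=
  (2 * gamma t * Num.sqrt (eta t) * rho_max h g t) ^+ 2.
Proof.
move=> fg /(adv_mean_neighboring _ _ _ _ eta h g f w)[l [s [s' E]]] t.
rewrite E csqnorm_scale_cvec cabs_scale.
rewrite [leRHS](_ : _ = Num.sqrt (eta t) ^+ 2 * rho_max h g t ^+ 2 * (2 * gamma t) ^+ 2); last by ring.
have r0 : 0 <= cabs (rho h g t l) by exact: sqrtr_ge0.
have rm := rho_max_ge _ _ h g t l.
apply: ler_pM; [by rewrite mulr_ge0 ?sqr_ge0|exact: sqr_ge0| |].
  by rewrite ler_wpM2l ?sqr_ge0// ler_pXn2r// nnegrE (le_trans r0).
exact: eucl_normB_sqr_le.
Qed.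

Lemma m_eff_gt0 (T K : nat) (eta : 'I_T -> R) (h g : 'I_T -> 'I_K -> R[i]) Rc Na :
  (forall t, 0 < eta t) -> (forall t, psd_c (Rc t)) -> 0 < Na ->
  forall t, 0 < m_eff eta h g Rc Na t.
Proof.
move=> eta0 psd Na0 t; rewrite sqrtr_gt0 ltr_wpDl// mulr_ge0 ?(ltW (eta0 t))//.
(* [psd_c] conjugates the left vector and [m_sq] the right one, hence the test vector is the
   conjugate of [rho]. *)
have := psd t (fun k => (rho h g t k)^*).
under eq_bigr => k _ do under eq_bigr => j _ do rewrite conjCK.
by rewrite lecE => /andP[_].
Qed.

End sensitivity.

(** * Probability of a bounded loss and the privacy guarantee *)

Lemma measurable_normr_affine_le {R : realType} (b c e : R) :
  measurable [set x : R | `|b + c * x| <= e].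
Proof.
rewrite (_ : [set x | _] = (fun x => `|b + c * x|) @^-1` `]-oo, e]%classic).
  rewrite -[X in measurable X]setTI.
  suff : measurable_fun setT (fun x : R => `|b + c * x|).
    by apply => //; exact: measurable_itv.
  by apply: measurableT_comp => //; exact: measurable_funD.
by apply/seteqP; split => x; rewrite /= in_itv.
Qed.

Lemma normal_prob_le_ge {R : realType} (s eps delta : R) :
  0 <= s -> 0 <= eps -> 0 < delta -> s < R_dp eps delta ->
  ((1 - delta)%:E <=
   normal_prob 0 1 [set x : R | (`|s + Num.sqrt 2 * (Num.sqrt s * x)| <= eps)%R])%E.
Proof.
move=> s0 e0 d0 sR; set G := [set x | _].
have mG : measurable G.
  exact: (measurable_normal_prob_lin _ _ (measurable_normr_affine_le _ _ _)).
have := lt_R_dp eps delta s d0 e0 s0 sR.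
have [] := C_invP delta^-1; first by rewrite invr_gt0.
set c := C_inv _ => c0 cE; set r := Num.sqrt s => se.
(* If the signals coincide the loss is 0, and the threshold [xi] below would divide by 0. *)
have [s00|sn0] := eqVneq s 0.
  have -> : G = setT.
    apply/seteqP; split => // x _.
    by rewrite /G /= s00 sqrtr0 mul0r mulr0 addr0 normr0.
  rewrite (_ : normal_prob 0 1 setT = 1%E); last exact: probability_setT.
  by rewrite lee_fin lerBlDr lerDl ltW.
have r0 : 0 < r by rewrite sqrtr_gt0 lt0r sn0.
have r2 : r ^+ 2 = s by rewrite sqr_sqrtr.
(* Chosen so that [s + 2 * r * xi = eps]: by the triangle inequality the bound can fail only where
   [|x|] exceeds [Num.sqrt 2 * xi]. *)
pose xi := (eps - s) / (2 * r).
have cxi : c < xi by rewrite ltr_pdivlMr ?mulr_gt0//; lra.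
pose H := [set x : R | Num.sqrt 2 * xi < `|x|].
have mH : measurable H.
  rewrite (_ : H = ~` [set x : R | `|0 + 1 * x| <= Num.sqrt 2 * xi]).
    by apply: measurableC; exact: measurable_normr_affine_le.
  by apply/seteqP; split => x; rewrite /H /= add0r mul1r ltNge => /negP.
apply: (@le_trans _ _ (normal_prob 0 1 (~` H))).
  rewrite (probability_setC (normal_prob 0 1) mH) EFinB leeB//.
  apply: (le_trans (normal_prob_tail xi _)); first exact: lt_trans cxi.
  rewrite lee_fin -[leRHS]invrK -cE lef_pV2 ?posrE ?C_fun_gt0//.
    by rewrite ler_C_fun// ltW.
  exact: lt_trans cxi.
apply: le_measure; [exact/mem_set/measurableC|exact/mem_set|].
move=> x /=; rewrite /H /= => /negP; rewrite -leNgt => xle.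
rewrite /G /=; apply: (le_trans (ler_normD _ _)).
have q0 : 0 < Num.sqrt 2 :> R by rewrite sqrtr_gt0.
rewrite (ger0_norm s0) !normrM (gtr0_norm q0) (gtr0_norm r0).
have -> : eps = s + Num.sqrt 2 * (r * (Num.sqrt 2 * xi)).
  have -> : Num.sqrt 2 * (r * (Num.sqrt 2 * xi)) = Num.sqrt 2 ^+ 2 * (r * xi).
    by ring.
  by rewrite sqr_sqrtr// /xi; field; rewrite gt_eqF.
by rewrite lerD2l ler_pM2l// ler_pM2l.
Qed.

Theorem theorem1 (R : realType) (d K T Dn : nat) (S : eqType)
  (dm : measure_display) (Om : measurableType dm) (P : probability Om R)
  (X : 'I_T * 'I_d * bool -> Om -> R)
  (f : 'rV[R]_d -> S -> 'rV[R]_d) (w : 'I_T -> 'rV[R]_d)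
  (eta gamma : 'I_T -> R) (h g : 'I_T -> 'I_K -> R[i])
  (Rc : 'I_T -> 'M[R[i]]_K) (Na eps delta : R) :
  iid_std_normal P X ->
  (forall t, 0 < eta t) ->
  (forall t k, h t k != 0) ->
  (forall t, psd_c (Rc t)) ->
  (forall t, \sum_(k < K) \sum_(j < K) Rc t k j = 0) ->
  0 < Na ->
  0 <= eps -> 0 < delta <= 1 ->
  (forall t (s : S), eucl_norm (f (w t) s) <= gamma t) ->
  \sum_(t < T) (2 * gamma t / m_eff eta h g Rc Na t * Num.sqrt (eta t)
                  * rho_max h g t) ^+ 2 < R_dp eps delta ->
  forall Dg Dg' : 'I_K -> seq S,
    (forall k, size (Dg k) = Dn) -> (forall k, size (Dg' k) = Dn) ->
    neighboring Dg Dg' ->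
    ((1 - delta)%:E <=
     P [set om : Om | (`| privacy_loss (m_eff eta h g Rc Na)
                          (adv_mean eta h g f w Dg) (adv_mean eta h g f w Dg')
                          (fun t => adv_mean eta h g f w Dg t
                                    + eff_noise (m_eff eta h g Rc Na) X t om) | <= eps)%R])%E.

Proof.
move=> Xiid eta0 _ psd _ Na0 eps0 /andP[delta0 _] fgamma sum_lt Dg Dg' _ _ nb.
set m := m_eff eta h g Rc Na.
have m0 : forall t, 0 < m t by exact: m_eff_gt0.
pose v t := adv_mean eta h g f w Dg t - adv_mean eta h g f w Dg' t.
pose a := mean_shift T d m v.
pose s := \sum_i a i ^+ 2.
have s0 : 0 <= s by apply: sumr_ge0 => i _; exact: sqr_ge0.
have s_lt : s < R_dp eps delta.
  apply: le_lt_trans sum_lt; rewrite /s sum_mean_shift_sqr; apply: ler_sum => t _.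
  rewrite [leRHS](_ : _ =
      (2 * gamma t * Num.sqrt (eta t) * rho_max h g t) ^+ 2 / m t ^+ 2).
    by rewrite ler_pM2r ?invr_gt0 ?exprn_gt0//; exact: csqnorm_adv_mean_le.
  by rewrite -/m; field; rewrite gt_eqF.
apply: (le_trans (normal_prob_le_ge s eps delta s0 eps0 delta0 s_lt)).
(* The loss is bounded by [eps] exactly when the linear form in the [X i] lies in [A], and that form
   has the law of [sqrt s] times a standard normal. *)
pose A := [set y : R | (`|s + Num.sqrt 2 * y| <= eps)%R].
have mA : measurable A by exact: measurable_normr_affine_le.
rewrite -(lin_comb_normal P X Xiid a A mA) le_eqVlt; apply/orP; left; apply/eqP.
by congr (P _); apply/seteqP; split => om; rewrite /A /= privacy_lossE.
Qed.
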